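(* Assume that: (U1) $A(s)$ is compact for every $s\in S$ and the correspondence $s\mapsto A(s)$ is upper semicontinuous; (U2) $u$ is upper semicontinuous on $\mathbb K$; (U3) $q$ is Feller, i.e. $(s,a)\mapsto\int_S v(s')q(ds'|s,a)$ is continuous on $\mathbb K$ for each bounded continuous $v:S\to\mathbb R$. Then there exists a unique solution $v^*\in\widehat{\mathcal U}$ to the Bellman equation $$v^*(s)=\max_{a\in A(s)}\left((1-\beta)u(s,a)^p+\beta[E(v^* )(s,a)]^p\right)^{1/p},\quad s\in S,\qquad E(v)(s,a):=\int_S v(s')\,q(ds'|s,a).$$ If instead (C1) $A(s)$ is compact for every $s\in S$ and the correspondence $s\mapsto A(s)$ is continuous, (C2) $u$ is continuous on $\mathbb K$, and (C3)=(U3) hold, then $v^*\in\widehat{\mathcal C}$.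
   Context: Model. $S$ (states) and $A$ (actions) are Borel spaces, i.e. non-empty Borel subsets of complete separable metric spaces. $\mathbb K\subset S\times A$ is a non-empty Borel set such that each section $A(s)=\{a\in A:(s,a)\in\mathbb K\}$, $s\in S$, is non-empty. $q$ is a Borel measurable transition probability from $\mathbb K$ to $S$. $u:\mathbb K\to\mathbb R$ is Borel measurable with $b_0\le u(s,a)\le b_1$ for all $(s,a)\in\mathbb K$, where $b_1>b_0>0$ are constants. $\beta\in[0,1)$ and $p<1$, $p\ne0$ are fixed real parameters. Constants and classes. $0<\epsilon<B$ are fixed constants chosen as follows: if $p<0$, then $\epsilon\le b_0$ and $B\ge(1-\beta)^{1/p}b_1$; if $p\in(0,1)$, then $\epsilon\le(1-\beta)^{1/p}b_0$ and $B\ge b_1$. $\widehat{\mathcal U}$ (resp. $\widehat{\mathcal C}$) is the set of all upper semicontinuous (resp. continuous) functions $v:S\to[\epsilon,B]$. A correspondence $\varphi$ from $S$ to a separable metric space $Z$ is upper (lower) semicontinuous if $\{s\in S:\varphi(s)\cap D\ne\emptyset\}$ is closed (open) for each closed (open) $D\subset Z$, and continuous if both. *)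

(* Defs.v *)
From HB Require Import structures.
From mathcomp Require Import all_boot all_order all_algebra.
From mathcomp Require Import all_classical all_reals all_analysis.

Set Implicit Arguments.
Unset Strict Implicit.
Unset Printing Implicit Defensive.

Import Order.TTheory GRing.Theory Num.Theory.
Import numFieldNormedType.Exports.

Local Open Scope classical_set_scope.
Local Open Scope ring_scope.

#[short(type="completeMetricType")]
HB.structure Definition CompleteMetric (R : realType) :=
  {T of CompletePseudoMetric R T & PseudoMetric_isMetric R T}.

Definition separable (T : topologicalType) : Prop :=
  exists2 D : set T, countable D & dense D.

Definition borel (T : topologicalType) := g_sigma_algebraType (@open T).

(* The nonemptiness field is what makes the subtype pointed below, as
   measurable types are required to be. *)
Record borel_set (T : topologicalType) := BorelSet {
  borel_set_val :> set T ;
  borel_set_measurable : <<s @open T >> borel_set_val ;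
  borel_set_nonempty : borel_set_val !=set0 }.

(* Through the coercions borel_set >-> set >-> Sortclass, a Borel set S is used
   as the type set_type S, whose topology is the relative one. *)
Section borel_set_pointed.
Context (T : topologicalType) (S : borel_set T).

Let borel_set_point : S.
Proof.
by have [x Sx] := cid (borel_set_nonempty S); exists x; rewrite inE.
Defined.

HB.instance Definition _ := isPointed.Build (set_type S) borel_set_point.

End borel_set_pointed.

Definition upper_semicontinuous (T : topologicalType) (R : realType)
    (f : T -> R) : Prop :=
  forall x a, f x < a -> exists2 V, nbhs x V & forall y, V y -> f y < a.

Section correspondences.
Context (S Z : topologicalType).
Implicit Type phi : S -> set Z.

Definition usc_correspondence phi :=
  forall D : set Z, closed D -> closed [set s | phi s `&` D !=set0].

Definition lsc_correspondence phi :=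
  forall D : set Z, open D -> open [set s | phi s `&` D !=set0].

Definition continuous_correspondence phi :=
  usc_correspondence phi /\ lsc_correspondence phi.

End correspondences.

Definition is_max (R : realType) (E : set R) (m : R) : Prop :=
  E m /\ ubound E m.

Section model.
Context (R : realType) (X Y : topologicalType).
Context (S : borel_set X) (A : borel_set Y) (K : borel_set (S * A)%type).

Definition feasible (s : S) : set A := [set a | (K : set (S * A)) (s, a)].

Context (q : R.-pker (borel K) ~> (borel S)).

Definition expect (v : S -> R) (k : K) : R :=
  Rintegral (q k) [set: borel S] v.

Definition feller : Prop :=
  forall v : S -> R, continuous v -> (exists M, forall s, `|v s| <= M) ->
  continuous (expect v).

Definition aggregator (beta p : R) (u : K -> R) (v : S -> R)
    (k : K) : R :=
  ((1 - beta) * u k `^ p + beta * expect v k `^ p) `^ p^-1.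

(* Ranging over a in A(s) amounts to ranging over the points k of K whose first
   coordinate is s. *)
Definition bellman (beta p : R) (u : K -> R) (v : S -> R) : Prop :=
  forall s : S,
    is_max [set aggregator beta p u v k | k in [set k : K | (val k).1 = s]]
           (v s).

Definition Uhat (epsilon B : R) : set (S -> R) :=
  [set v | upper_semicontinuous v /\ forall s, epsilon <= v s <= B].

Definition Chat (epsilon B : R) : set (S -> R) :=
  [set v | continuous v /\ forall s, epsilon <= v s <= B].

End model.

(* Main.v *)
(* The aggregator ces(x, y) = ((1 - beta) x^p + beta y^p)^(1/p) is increasing and
   homogeneous, and since x and y stay in compact subsets of ]0, +oo[ the weight
   of y is at most some k < 1, so that scaling y by l >= 1 scales ces by at most
   l' = (1 - k + k l^p)^(1/p), where l'^p - 1 = k (l^p - 1).  Hence the iterates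
   L_n and U_n of the Bellman operator from the constants epsilon and B satisfy
   L_n <= U_n <= l_n L_n with l_n --> 1, and every solution lies between them:
   this gives uniqueness.  The common limit is the infimum of the U_n, hence
   upper semicontinuous, and monotonicity makes it a fixed point.  In the
   continuous case it is also the supremum of the continuous functions L_n.

   The operator preserves upper semicontinuity by Berge's maximum theorem, and
   because E(v) is the decreasing limit of the expectations of the Lipschitz
   envelopes of v, which are continuous by the Feller property. *)

Require Import Defs.
From HB Require Import structures.
From mathcomp Require Import all_boot all_order all_algebra.
From mathcomp Require Import all_classical all_reals all_analysis.
From mathcomp Require Import measurable_realfun ring lra.

Set Implicit Arguments.
Unset Strict Implicit.
Unset Printing Implicit Defensive.

Import Order.TTheory GRing.Theory Num.Theory.
Import numFieldNormedType.Exports.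

Local Open Scope classical_set_scope.
Local Open Scope ring_scope.

(** * The CES aggregator on positive reals *)

Section ces.
Context (R : realType).
Implicit Types beta p x y l k : R.

Lemma powR_powRV p x : p != 0 -> 0 <= x -> (x `^ p) `^ p^-1 = x.
Proof. by move=> p0 x0; rewrite -powRrM divff// powRr1. Qed.

Lemma powRV_powR p x : p != 0 -> 0 <= x -> (x `^ p^-1) `^ p = x.
Proof. by move=> p0 x0; rewrite -powRrM mulVf// powRr1. Qed.

Lemma gt0_powR_le p x y : 0 <= p -> 0 < x -> x <= y -> x `^ p <= y `^ p.
Proof.
move=> p0 x0 xy; apply: ge0_ler_powR => //; rewrite nnegrE ltW//.
exact: lt_le_trans xy.
Qed.

Lemma lt0_powR_ge p x y : p <= 0 -> 0 < x -> x <= y -> y `^ p <= x `^ p.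
Proof.
move=> p0 x0 xy; rewrite -(opprK p) !(powRN _ (- p)).
rewrite lef_pV2 ?posrE ?powR_gt0 ?(lt_le_trans x0)//.
by apply: gt0_powR_le => //; rewrite oppr_ge0.
Qed.

(** The constant elasticity of substitution aggregator: [aggregator] unfolds to it at [u k] and
    [expect q v k]. With weight k and first argument 1 it also serves as the scaling factor of the
    contraction estimate. *)
Definition ces beta p x y := ((1 - beta) * x `^ p + beta * y `^ p) `^ p^-1.

Lemma ces_sum_gt0 beta p x y : 0 <= beta < 1 -> 0 < x ->
  0 < (1 - beta) * x `^ p + beta * y `^ p.
Proof.
move=> /andP[b0 b1] x0; apply: ltr_wpDr; first by rewrite mulr_ge0// powR_ge0.
by rewrite mulr_gt0 ?subr_gt0// powR_gt0.
Qed.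

Lemma ces_gt0 beta p x y : 0 <= beta < 1 -> 0 < x -> 0 < ces beta p x y.
Proof. by move=> b x0; rewrite powR_gt0// ces_sum_gt0. Qed.

(** For p < 0 the inner powers and the outer power 1/p are both decreasing, so the composition is
    increasing for either sign of p. *)
Lemma ces_le beta p x x' y y' : 0 <= beta < 1 -> p != 0 ->
  0 < x -> x <= x' -> 0 < y -> y <= y' -> ces beta p x y <= ces beta p x' y'.
Proof.
move=> bb p0 x0 xx y0 yy; have x0' := lt_le_trans x0 xx.
have /andP[b0 b1] := bb; have b1' : 0 <= 1 - beta by rewrite subr_ge0 ltW.
have [pn|pp] := ltP p 0.
  apply: lt0_powR_ge; rewrite ?invr_le0 ?(ltW pn) ?ces_sum_gt0//.
  by rewrite lerD// ler_wpM2l// lt0_powR_ge// ltW.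
apply: gt0_powR_le; rewrite ?invr_ge0 ?ces_sum_gt0//.
by rewrite lerD// ler_wpM2l// gt0_powR_le.
Qed.

Lemma cesM beta p x y l : 0 <= beta < 1 -> p != 0 -> 0 < x -> 0 < y -> 0 <= l ->
  ces beta p (l * x) (l * y) = l * ces beta p x y.
Proof.
move=> bb p0 x0 y0 l0; have Z := ltW (ces_sum_gt0 p y bb x0).
rewrite /ces !powRM ?(ltW x0) ?(ltW y0)//.
rewrite (_ : _ + _ = l `^ p * ((1 - beta) * x `^ p + beta * y `^ p)); last ring.
by rewrite powRM ?powR_ge0// powR_powRV.
Qed.

Lemma ces_diag beta p x : p != 0 -> 0 <= x -> ces beta p x x = x.
Proof. by move=> p0 x0; rewrite /ces -mulrDl subrK mul1r powR_powRV. Qed.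

(** Since [powR] sends base 0 to 0 for every nonzero exponent, even a negative one, y = 0 drops the
    second term of the sum. For p < 0 this value is the limit of [ces] as y tends to infinity, not
    to 0. *)
Lemma cesr0 beta p x : p != 0 -> beta <= 1 -> 0 <= x ->
  ces beta p x 0 = (1 - beta) `^ p^-1 * x.
Proof.
move=> p0 b1 x0; rewrite /ces powR0// mulr0 addr0.
by rewrite powRM ?subr_ge0// ?powR_ge0// powR_powRV.
Qed.

(** One bound comes from monotonicity and the diagonal value [ces_diag], the other from dropping the
    nonnegative term beta y^p. For p < 0 dropping it raises the value and so gives the upper bound;
    for p > 0 the two roles are exchanged. Hence the two choices of epsilon and B. *)
Lemma ces_bounds beta p x y b0 b1 epsilon B :
  0 <= beta < 1 -> p != 0 -> 0 < b0 -> 0 < epsilon ->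
  (p < 0 -> epsilon <= b0 /\ (1 - beta) `^ p^-1 * b1 <= B) ->
  (0 < p -> epsilon <= (1 - beta) `^ p^-1 * b0 /\ b1 <= B) ->
  b0 <= x <= b1 -> epsilon <= y <= B -> epsilon <= ces beta p x y <= B.
Proof.
move=> bb p0 b00 e0 hn hp /andP[bx xb] /andP[ey yB].
have x0 := lt_le_trans b00 bx; have y0 := lt_le_trans e0 ey.
have /andP[beta0 beta1] := bb.
have bn : 0 <= beta * y `^ p by rewrite mulr_ge0// powR_ge0.
have cn : 0 < (1 - beta) * x `^ p by rewrite mulr_gt0 ?subr_gt0 ?powR_gt0.
have cesx0 := @cesr0 beta p x p0 (ltW beta1) (ltW x0).
rewrite /ces powR0// mulr0 addr0 in cesx0.
have [pn|pp] := ltP p 0.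
  have [eb bB] := hn pn; apply/andP; split.
    have := @ces_le beta p epsilon x epsilon y bb p0 e0 (le_trans eb bx) e0 ey.
    by rewrite ces_diag// ltW.
  apply: (le_trans _ bB); apply: (le_trans _ (ler_wpM2l (powR_ge0 _ _) xb)).
  rewrite -cesx0; apply: lt0_powR_ge => //; last by rewrite lerDl.
  by rewrite invr_le0 ltW.
have [eb bB] : epsilon <= (1 - beta) `^ p^-1 * b0 /\ b1 <= B.
  by apply: hp; rewrite lt_neqAle eq_sym p0.
apply/andP; split; last first.
  have := @ces_le beta p x B y B bb p0 x0 (le_trans xb bB) y0 yB.
  by rewrite ces_diag// (le_trans (ltW y0)).
apply: (le_trans eb); apply: (le_trans (ler_wpM2l (powR_ge0 _ _) bx)).
rewrite -cesx0; apply: gt0_powR_le => //; last by rewrite lerDl.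
by rewrite invr_ge0.
Qed.

(** Let Z be the sum inside ces(x, y) and w = beta y^p / Z, so that w <= k. Then ces(x, l y)^p = Z
    (1 - w + w l^p), while the right-hand side has p-th power Z (1 - k + k l^p). As l^p - 1 has the
    sign of p, replacing w by k moves the p-th power in the direction that increases the value. *)
Lemma ces_subhomogeneous beta p x y l k : 0 <= beta < 1 -> p != 0 ->
  0 < x -> 0 < y -> 1 <= l -> 0 <= k <= 1 ->
  beta * y `^ p <= k * ((1 - beta) * x `^ p + beta * y `^ p) ->
  ces beta p x (l * y) <= ces k p 1 l * ces beta p x y.
Proof.
move=> bb p0 x0 y0 l1 /andP[k0 k1] bk.
have l0 : 0 < l := lt_le_trans ltr01 l1.
have Z0 := @ces_sum_gt0 beta p x y bb x0.
rewrite /ces powR1 mulr1 powRM ?(ltW l0) ?(ltW y0)//.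
set b := y `^ p in bk Z0 *; set a := x `^ p in bk Z0 *; set m := l `^ p.
have m0 : 0 < m by rewrite powR_gt0.
have one_p : 1 `^ p = 1 :> R by rewrite powR1.
rewrite -[leRHS]powRM ?(ltW Z0)//; last first.
  by rewrite addr_ge0 ?subr_ge0 ?mulr_ge0// (ltW m0).
have [pn|pp] := ltP p 0.
  have m1 : m <= 1 by rewrite -one_p; apply: lt0_powR_ge; rewrite ?(ltW pn).
  apply: lt0_powR_ge; rewrite ?invr_le0 ?(ltW pn)//; last by nra.
  (* At k = 1 the term 1 - k vanishes, so positivity of 1 - k + k m comes from k m unless k = 0. *)
  rewrite mulr_gt0//; have [->|k0'] := eqVneq k 0; first by rewrite mul0r addr0 subr0.
  by rewrite ltr_wpDl ?subr_ge0// mulr_gt0// lt_neqAle eq_sym k0'.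
have m1 : 1 <= m by rewrite -one_p; apply: gt0_powR_le.
apply: gt0_powR_le; rewrite ?invr_ge0//; last by nra.
rewrite mulrCA -/b; move/andP: bb => [beta0 beta1].
apply: ltr_wpDr; first by rewrite !mulr_ge0 ?powR_ge0 // ltW.
by rewrite mulr_gt0 ?subr_gt0// powR_gt0.
Qed.

(** The weight of y grows with y^p and shrinks with x^p, so it is at most its value at an upper
    bound M of y^p and a lower bound m of x^p. That value is below 1 because (1 - beta) m > 0. The
    sign of p decides which endpoints give m and M. *)
Lemma ces_weight_bound beta p b0 b1 epsilon B :
  0 <= beta < 1 -> 0 < b0 -> b0 <= b1 -> 0 < epsilon -> epsilon <= B ->
  exists2 k, 0 <= k < 1 & forall x y, b0 <= x <= b1 -> epsilon <= y <= B ->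
    beta * y `^ p <= k * ((1 - beta) * x `^ p + beta * y `^ p).
Proof.
move=> /andP[beta0 beta1] b00 b01 e0 eB.
have [m [M [m0 M0 mM]]] : exists m M, [/\ 0 < m, 0 < M &
    forall x y, b0 <= x <= b1 -> epsilon <= y <= B ->
    m <= x `^ p /\ y `^ p <= M].
  have [pp|pn] := leP 0 p.
    exists (b0 `^ p), (B `^ p).
    split; rewrite ?powR_gt0 ?(lt_le_trans e0 eB)// => x y /andP[bx _] /andP[ey yB].
    by split; apply: gt0_powR_le => //; exact: lt_le_trans ey.
  exists (b1 `^ p), (epsilon `^ p).
  split; rewrite ?powR_gt0 ?(lt_le_trans b00 b01)// => x y /andP[bx xb] /andP[ey _].
  by split; apply: lt0_powR_ge => //; rewrite ?(ltW pn)//; exact: lt_le_trans bx.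
have am : 0 < (1 - beta) * m by rewrite mulr_gt0// subr_gt0.
have bM : 0 <= beta * M by rewrite mulr_ge0// ltW.
have D0 : 0 < (1 - beta) * m + beta * M by rewrite ltr_wpDr.
exists (beta * M / ((1 - beta) * m + beta * M)).
  by rewrite divr_ge0 ?(ltW D0)//= ltr_pdivrMr// mul1r ltrDr.
move=> x y xb yb; have [mx yM] := mM x y xb yb.
rewrite mulrAC ler_pdivlMr//.
have y0 := powR_ge0 y p.
have h : y `^ p * m <= M * x `^ p by rewrite ler_pM// ltW.
have b1' : 0 <= 1 - beta by rewrite subr_ge0 ltW.
have := ler_wpM2l (mulr_ge0 beta0 b1') h; nra.
Qed.

Lemma ces_ge1 k p l : 0 <= k < 1 -> p != 0 -> 1 <= l -> 1 <= ces k p 1 l.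
Proof.
move=> kk p0 l1; rewrite -[leLHS](ces_diag k p0 ler01).
by apply: ces_le.
Qed.

(** In the variable l^p the iterated map is affine with fixed point 1 and ratio k, which gives a
    closed form; continuity of the power 1/p at 1 transfers the limit. *)
Lemma iter_ces_cvg1 k p l : 0 <= k < 1 -> p != 0 -> 1 <= l ->
  iter n (ces k p 1) l @[n --> \oo] --> (1 : R).
Proof.
move=> kk p0 l1; have /andP[k0 k1] := kk.
have iter1 n : 1 <= iter n (ces k p 1) l.
  by elim: n => //= n IH; exact: ces_ge1.
have E n : (iter n (ces k p 1) l) `^ p = 1 + k ^+ n * (l `^ p - 1).
  elim: n => [|n IH] /=; first by rewrite expr0 mul1r addrC subrK.
  rewrite {1}/ces powRV_powR ?(ltW (ces_sum_gt0 _ _ _ _))// IH powR1 exprS; ring.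
have c1 : (iter n (ces k p 1) l) `^ p @[n --> \oo] --> (1 : R).
  under eq_fun do rewrite E.
  have : 1 + k ^+ n * (l `^ p - 1) @[n --> \oo] --> 1 + 0 * (l `^ p - 1).
    apply: cvgD; first exact: cvg_cst.
    by apply: cvgM; [apply: cvg_expr; rewrite ger0_norm|exact: cvg_cst].
  by rewrite mul0r addr0.
have E2 n : iter n (ces k p 1) l = ((iter n (ces k p 1) l) `^ p) `^ p^-1.
  by rewrite powR_powRV// (le_trans ler01 (iter1 n)).
under eq_fun do rewrite E2.
have c2 : {for (1:R), continuous (fun x : R => x `^ p^-1)}.
  apply: differentiable_continuous; apply/derivable1_diffP.
  by apply: derivable_powR; rewrite in_itv/= ltr01.
have := cvg_comp _ _ c1 c2; rewrite powR1; exact.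
Qed.

End ces.

(* The library's lower_semicontinuous is about functions into \bar R. *)
Definition lower_semicontinuousR (T : topologicalType) (R : realType)
    (f : T -> R) : Prop :=
  forall x a, a < f x -> exists2 V, nbhs x V & forall y, V y -> a < f y.

(** * Real-valued semicontinuous functions *)

Section semicontinuity.
Context (T : topologicalType) (R : realType).
Implicit Types f g : T -> R.

Lemma uscP f :
  upper_semicontinuous f <-> forall x a, f x < a -> \near x, f x < a.
Proof.
split=> h x a /h; first by move=> [V Vx Va]; exact: filterS Vx.
by move=> n; exists [set y | f y < a].
Qed.

Lemma lscP f :
  lower_semicontinuousR f <-> forall x a, a < f x -> \near x, a < f x.
Proof.
split=> h x a /h; first by move=> [V Vx Va]; exact: filterS Vx.
by move=> n; exists [set y | a < f y].
Qed.

Lemma continuous_usc_lsc f :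
  continuous f <-> upper_semicontinuous f /\ lower_semicontinuousR f.
Proof.
split=> [cf|[/uscP uf /lscP lf] x].
  split; [apply/uscP|apply/lscP] => x a.
    exact: cvgr_lt (cf x) _.
  exact: cvgr_gt (cf x) _.
apply/cvgrPdist_lt => e e0.
have u : \forall y \near x, f y < f x + e by apply: uf; rewrite ltrDl.
have l : \forall y \near x, f x - e < f y by apply: lf; rewrite gtrDl oppr_lt0.
near=> y; rewrite distrC ltr_distl; apply/andP; split; near: y; [exact: l|exact: u].
Unshelve. all: by end_near. Qed.

Lemma continuous_dist f : (forall x e, 0 < e ->
  \forall y \near x, `|f x - f y| < e) -> continuous f.
Proof. by move=> h x; apply/cvgrPdist_lt; exact: h. Qed.

Lemma usc_cst (r : R) : upper_semicontinuous (fun _ : T => r).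
Proof. by move=> x a ra; exists setT => //; exact: filterT. Qed.

Lemma usc_scale f (l : R) : 0 < l -> upper_semicontinuous f ->
  upper_semicontinuous (fun x => l * f x).
Proof.
move=> l0 uf x a; rewrite mulrC -ltr_pdivlMr// => /uf [V Vx Va].
by exists V => // y /Va; rewrite ltr_pdivlMr// mulrC.
Qed.

Lemma usc_inf (I : Type) (F : I -> T -> R) f :
  (forall i, upper_semicontinuous (F i)) -> (forall i x, f x <= F i x) ->
  (forall x a, f x < a -> exists i, F i x < a) -> upper_semicontinuous f.
Proof.
move=> uF fF infF; apply/uscP => x a /infF [i Fi].
apply: filterS ((uscP (F i)).1 (uF i) x a Fi) => y.
exact: le_lt_trans.
Qed.

Lemma lsc_sup (I : Type) (F : I -> T -> R) f :
  (forall i, lower_semicontinuousR (F i)) -> (forall i x, F i x <= f x) ->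
  (forall x a, a < f x -> exists i, a < F i x) -> lower_semicontinuousR f.
Proof.
move=> uF fF infF; apply/lscP => x a /infF [i Fi].
apply: filterS ((lscP (F i)).1 (uF i) x a Fi) => y ay.
exact: lt_le_trans (fF i y).
Qed.

Lemma usc_open f a : upper_semicontinuous f -> open [set x | f x < a].
Proof. by move=> /uscP uf; rewrite openE => x /= /uf. Qed.

(* By homogeneity of ces, moving both arguments by a factor l moves its value by
   exactly l, so no continuity of powR is needed here and in ces_lsc. *)
Lemma ces_usc (beta p : R) f g : 0 <= beta < 1 -> p != 0 ->
  (forall x, 0 < f x) -> (forall x, 0 < g x) ->
  upper_semicontinuous f -> upper_semicontinuous g ->
  upper_semicontinuous (fun x => ces beta p (f x) (g x)).
Proof.
move=> bb p0 f0 g0 /uscP uf /uscP ug; apply/uscP => x a fa.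
have c0 := @ces_gt0 R beta p (f x) (g x) bb (f0 x).
have [l l1 la] : exists2 l, 1 < l & l * ces beta p (f x) (g x) < a.
  have r1 : 1 < a / ces beta p (f x) (g x) by rewrite ltr_pdivlMr// mul1r.
  by exists ((1 + a / ces beta p (f x) (g x)) / 2); rewrite -?ltr_pdivlMr//; lra.
have l0 := lt_trans ltr01 l1.
have ux : \forall y \near x, f y < l * f x by apply: uf; rewrite ltr_pMl.
have vx : \forall y \near x, g y < l * g x by apply: ug; rewrite ltr_pMl.
apply: filterS2 ux vx => y /ltW fy /ltW gy; apply: le_lt_trans la.
rewrite -(cesM bb p0 (f0 x) (g0 x) (ltW l0)).
exact: (ces_le bb p0 (f0 y) fy (g0 y) gy).
Qed.

Lemma ces_lsc (beta p : R) f g : 0 <= beta < 1 -> p != 0 ->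
  (forall x, 0 < f x) -> (forall x, 0 < g x) ->
  lower_semicontinuousR f -> lower_semicontinuousR g ->
  lower_semicontinuousR (fun x => ces beta p (f x) (g x)).
Proof.
move=> bb p0 f0 g0 /lscP uf /lscP ug; apply/lscP => x a fa.
have c0 := @ces_gt0 R beta p (f x) (g x) bb (f0 x).
(* For a <= 0 the midpoint chosen below might not be positive, but then every value of [ces] exceeds
   a. *)
have [a0|a0] := leP a 0.
  by apply: nearW => y; apply: (le_lt_trans a0); exact: ces_gt0.
have [l /andP[l0 l1] la] :
    exists2 l, 0 < l < 1 & a < l * ces beta p (f x) (g x).
  have r0 : 0 < a / ces beta p (f x) (g x) by rewrite divr_gt0.
  have r1 : a / ces beta p (f x) (g x) < 1 by rewrite ltr_pdivrMr// mul1r.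
  exists ((1 + a / ces beta p (f x) (g x)) / 2); rewrite -?ltr_pdivrMr//; last lra.
  by apply/andP; split; lra.
have ux : \forall y \near x, l * f x < f y by apply: uf; rewrite gtr_pMl.
have vx : \forall y \near x, l * g x < g y by apply: ug; rewrite gtr_pMl.
apply: filterS2 ux vx => y /ltW fy /ltW gy; apply: lt_le_trans la _.
rewrite -(cesM bb p0 (f0 x) (g0 x) (ltW l0)).
exact: (ces_le bb p0 (mulr_gt0 l0 (f0 x)) fy (mulr_gt0 l0 (g0 x)) gy).
Qed.

End semicontinuity.

(** * Approximation of semicontinuous functions by Lipschitz ones from above *)

Section lipschitz_envelope.
Context (R : realType) (X : metricType R) (S : set X) (v : S -> R) (lo hi : R)
  (v_bounds : forall s, lo <= v s <= hi).

Let d (s t : S) : R := mdist (val s) (val t).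

(** The sup-convolution of v with n times the distance, that is, the least n-Lipschitz majorant of
    v. *)
Definition lipschitz_envelope (n : nat) (s : S) : R :=
  sup [set v t - n%:R * d s t | t in [set: S]].

Let d_ge0 s t : 0 <= d s t. Proof. exact: mdist_ge0. Qed.

Let env_has_sup n s : has_sup [set v t - n%:R * d s t | t in [set: S]].
Proof.
split; first by exists (v s - n%:R * d s s), s.
exists hi => _ [t _ <-]; rewrite lerBlDr; apply: ler_wpDr.
  by rewrite mulr_ge0.
by case/andP: (v_bounds t).
Qed.

Lemma lipschitz_envelope_ge n s t : v t - n%:R * d s t <= lipschitz_envelope n s.
Proof. by apply: (sup_upper_bound (env_has_sup n s)); exists t. Qed.

Lemma lipschitz_envelope_le n s a :
  (forall t, v t - n%:R * d s t <= a) -> lipschitz_envelope n s <= a.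
Proof.
move=> h; apply: ge_sup; first by case: (env_has_sup n s).
by move=> _ [t _ <-].
Qed.

Lemma lipschitz_envelope_bounds n s : v s <= lipschitz_envelope n s <= hi.
Proof.
apply/andP; split.
  by have := lipschitz_envelope_ge n s s; rewrite /d mdistxx mulr0 subr0.
apply: lipschitz_envelope_le => t; rewrite lerBlDr ler_wpDr ?mulr_ge0//.
by case/andP: (v_bounds t).
Qed.

Lemma lipschitz_envelope_lip n s t :
  lipschitz_envelope n s <= lipschitz_envelope n t + n%:R * d s t.
Proof.
have tri r : d t r <= d s t + d s r.
  by rewrite /d (metric_sym (val s) (val t)); exact: metric_triangle.
apply: lipschitz_envelope_le => r.
have := ler_wpM2l (ler0n R n) (tri r); have := lipschitz_envelope_ge n t r.
by rewrite mulrDr; lra.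
Qed.

Lemma lipschitz_envelope_continuous n : continuous (lipschitz_envelope n).
Proof.
apply: continuous_dist => s e e0.
(* The radius is e / (n + 1) because n may be 0; the ball is taken in X, whose topology induces that
   of S. *)
have n1 : 0 < (n%:R + 1 : R) by rewrite ltr_wpDl.
have h : \forall t \near s, ball (set_val s) (e / (n%:R + 1)) (set_val t).
  exact: (@initial_continuous _ _ set_val s _ (nbhsx_ballx _ _ (divr_gt0 e0 n1))).
apply: filterS h => t; rewrite ballEmdist /= ltr_pdivlMr// => dst.
have dst' : n%:R * d s t < e.
  by apply: le_lt_trans dst; rewrite mulrC ler_wpM2l// lerDl.
have := lipschitz_envelope_lip n s t; have := lipschitz_envelope_lip n t s.
have -> : d t s = d s t by rewrite /d metric_sym.
rewrite ltr_distl; move: dst'; set x := _ * _; lra.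
Qed.

(** Points t within a suitable r of s have v t < v s + e by semicontinuity. Points farther away are
    penalized by at least n r, which for large n exceeds hi - lo and brings their contribution down
    to lo <= v s. *)
Lemma lipschitz_envelope_cvg s : upper_semicontinuous v ->
  lipschitz_envelope n s @[n --> \oo] --> v s.
Proof.
move=> /uscP uv; apply/cvgrPdist_le => e e0.
have : \forall t \near s, v t < v s + e by apply: uv; rewrite ltrDl.
move=> [_ [[W oW <-] /= Ws]] Wv.
have /nbhs_ballP [r /= r0 rW] := open_nbhs_nbhs (conj oW Ws).
near=> n.
have /andP[vn nh] := lipschitz_envelope_bounds n s.
rewrite ler0_norm ?subr_le0// opprB lerBlDl; apply: lipschitz_envelope_le => t.
have [dr|dr] := ltP (d s t) r.
  rewrite lerBlDr; apply: ler_wpDr; first by rewrite mulr_ge0.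
  by apply/ltW/Wv/rW; rewrite ballEmdist.
have /andP[_ vt] := v_bounds t; have /andP[vs _] := v_bounds s.
have : (hi - lo) / r <= n%:R by near: n; exact: nbhs_infty_ger.
rewrite ler_pdivrMr// => hn.
have : n%:R * r <= n%:R * d s t by rewrite ler_wpM2l.
lra.
Unshelve. all: by end_near. Qed.

End lipschitz_envelope.

(** * Berge's maximum theorem *)

Section maximum_theorem.
Context (R : realType) (S Z : topologicalType) (K : set (S * Z)).
Implicit Types (f : K -> R) (V : S -> R).

(** Convertible with [feasible], but stated for an arbitrary subset of a product. *)
Definition fiber (s : S) : set Z := [set a | K (s, a)].

(** Passes from the relative topology of K to the product topology, where neighbourhoods contain
    boxes U x W. *)
Lemma near_set_val (k0 : K) (P : K -> Prop) : (\forall k \near k0, P k) ->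
  \forall x \near val k0, forall k, val k = x -> P k.
Proof.
move=> [_ [[W oW <-] /= Wk]] WP.
apply: (filterS _ (open_nbhs_nbhs (conj oW Wk))) => x Wx k kx.
by apply: WP; rewrite -kx in Wx; exact: Wx.
Qed.

(** If the supremum were not attained, each point of the fiber would have a neighbourhood where f
    stays below some c0 < sup. Compactness, as a near-covering property along the left
    neighbourhoods of the supremum, then yields one c < sup bounding f on the whole fiber. *)
Lemma usc_max_attained f s : upper_semicontinuous f ->
  (exists M, forall k, f k <= M) -> compact (fiber s) -> fiber s !=set0 ->
  exists m, is_max [set f k | k in [set k : K | (val k).1 = s]] m.
Proof.
move=> /uscP uf [M fM] /compact_near_coveringP cs [a0 Ka0].
pose E := [set f k | k in [set k : K | (val k).1 = s]].
have supE : has_sup E.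
  split; last by exists M => _ [k _ <-].
  by exists (f (exist _ (s, a0) (mem_set Ka0))); eexists; last reflexivity.
exists (sup E); split; last exact: sup_upper_bound.
apply: contrapT => nE.
have lt_sup k : (val k).1 = s -> f k < sup E.
  move=> ks; have Ek : E (f k) by exists k.
  rewrite lt_neqAle (sup_upper_bound supE) // andbT.
  by apply/eqP => e; apply: nE; rewrite -e.
have : \forall c \near (sup E)^'-,
    fiber s `<=` [set a | forall k, val k = (s, a) -> f k < c].
  apply: cs => a Ka.
  pose k0 : K := exist _ (s, a) (mem_set Ka).
  pose c0 := (f k0 + sup E) / 2.
  have := lt_sup k0 erefl => fk0.
  have /near_set_val : \forall k \near k0, f k < c0 by apply: uf; rewrite /c0; lra.
  move=> [[/= U W] [/= nU nW] UW].
  exists (W, [set c | c0 < c]); first split => //=.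
    by apply: nbhs_left_gt; rewrite /c0; lra.
  move=> [a' c] /= [Wa' c0c] k ka'; apply: lt_trans c0c.
  by apply: (UW (s, a')) => //; split => //=; exact: nbhs_singleton.
move=> h; have [c [/= hc cE]] : exists c,
    fiber s `<=` [set a | forall k, val k = (s, a) -> f k < c] /\ c < sup E.
  apply: (@filter_ex _ ((sup E)^'-)); near=> c; split; near: c => //.
  exact: nbhs_left_lt.
have : sup E <= c.
  apply: ge_sup; first by case: supE.
  move=> _ [k /= ks <-]; apply/ltW/(hc (val k).2).
    by rewrite /fiber /= -ks -surjective_pairing; exact/set_mem/valP.
  by rewrite -ks -surjective_pairing.
by rewrite leNgt cE.
Unshelve. all: by end_near. Qed.

(** Compactness gives a neighbourhood U of s and an open W containing the fiber at s such that f < c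
    at the points of K in U x W. Upper semicontinuity of the correspondence keeps nearby fibers, and
    hence their maximizers, inside W. *)
Lemma usc_max f V : upper_semicontinuous f ->
  (forall s, compact (fiber s)) -> usc_correspondence fiber ->
  (forall s, is_max [set f k | k in [set k : K | (val k).1 = s]] (V s)) ->
  upper_semicontinuous V.
Proof.
move=> /uscP uf cK uK mV; apply/uscP => s c Vc.
pose Q (U : set S) (a : Z) := forall t, U t -> forall k, val k = (t, a) -> f k < c.
have /compact_near_coveringP cs := cK s.
(* Near-covering along the filter of small neighbourhoods of s makes a single U serve every point of
   the fiber. *)
have : \forall U \near powerset_filter_from (nbhs s),
    fiber s `<=` [set a | \forall b \near a, Q U b].
  apply: cs => a Ka.
  pose k0 : K := exist _ (s, a) (mem_set Ka).
  have /near_set_val : \forall k \near k0, f k < c.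
    by apply: uf; apply: le_lt_trans Vc; apply: (mV s).2; exists k0.
  move=> [[/= U W] [/= nU nW] UW].
  exists (W^°, [set U' | U' `<=` U]) => /=.
    split; first exact: nbhs_interior.
    exact: small_set_sub.
  move=> [a' U'] /= [Wa' U'U]; apply: filterS Wa' => b Wb t U't k kb.
  by apply: (UW (t, b)) => //; split => //=; exact: U'U.
move=> /near_powerset_filter_fromP [].
  move=> U U' UU' h a Ka; apply: filterS (h a Ka) => b Qb t Ut.
  by apply: Qb; exact: UU'.
move=> U nU hU.
pose W := [set a | Q U a]°.
have oC : open [set t | fiber t `<=` W].
  rewrite -[X in open X]setCK openC.
  (* A fiber fails to lie in W exactly when it meets the closed complement of W, which is the form
     [usc_correspondence] handles. *)
  have -> : ~` [set t | fiber t `<=` W] = [set t | fiber t `&` ~` W !=set0].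
    apply/seteqP; split=> t /=.
      by move=> /existsNP [a /not_implyP [Ka nW]]; exists a.
    by move=> [a [Ka nW]] h; apply: nW; exact: h.
  by apply: uK; rewrite closedC; exact: open_interior.
have nC : nbhs s [set t | fiber t `<=` W] by apply: open_nbhs_nbhs; split.
apply: (filterS2 _ _ nC nU) => t /= tW Ut.
have [[k /= kt <-] _] := mV t.
have Wk : W (val k).2.
  by apply: tW; rewrite /fiber /= -kt -surjective_pairing; exact/set_mem/valP.
have QW : Q U (val k).2 := interior_subset Wk.
by apply: (QW t Ut k); rewrite -kt -surjective_pairing.
Qed.

(** Around a maximizer at s there is a box U x W on which f > c. Nearby fibers still meet the
    interior of W, and any point where they do bounds the maximum from below. *)
Lemma lsc_max f V : lower_semicontinuousR f -> lsc_correspondence fiber ->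
  (forall s, is_max [set f k | k in [set k : K | (val k).1 = s]] (V s)) ->
  lower_semicontinuousR V.
Proof.
move=> /lscP lf lK mV; apply/lscP => s c cV.
have [[k0 /= k0s fk0] _] := mV s.
have /near_set_val : \forall k \near k0, c < f k by apply: lf; rewrite fk0.
move=> [[/= U W] [/= nU nW] UW].
have oL : open [set t | fiber t `&` W^° !=set0] by apply: lK; exact: open_interior.
have nL : nbhs s [set t | fiber t `&` W^° !=set0].
  apply: open_nbhs_nbhs; split => //; exists (val k0).2; split => //.
  by rewrite /fiber /= -k0s -surjective_pairing; exact/set_mem/valP.
rewrite k0s in nU; apply: (filterS2 _ _ nL nU) => t /= [a [Ka Wa]] Ut.
pose k : K := exist _ (t, a) (mem_set Ka).
apply: (@lt_le_trans _ _ (f k)); last by apply: (mV t).2; exists k.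
by apply: (UW (t, a)) => //; split => //=; exact: interior_subset.
Qed.

End maximum_theorem.

(** * Expectations of bounded semicontinuous functions *)

Section expectation.
Context (R : realType) (X Y : topologicalType).
Context (S : borel_set X) (A : borel_set Y) (K : borel_set (S * A)%type).
Context (q : R.-pker (borel K) ~> (borel S)).
Implicit Types (v w : S -> R) (k : K).

Lemma usc_measurable v : upper_semicontinuous v ->
  measurable_fun [set: borel S] v.
Proof.
move=> uv; apply: (measurability _ (RGenInftyO.measurableE R)).
move=> /= _ [_ [a ->] <-]; apply: measurableI => //.
apply: sub_sigma_algebra; rewrite preimage_itvNyo; exact: usc_open.
Qed.

Lemma usc_bounded_integrable v lo hi k : upper_semicontinuous v ->
  (forall s, lo <= v s <= hi) -> (q k).-integrable [set: borel S] (EFin \o v).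
Proof.
move=> uv vb; apply: measurable_bounded_integrable => //.
- by rewrite prob_kernel ltry.
- exact: usc_measurable.
- exists (`|lo| + `|hi|); split; first exact: num_real.
  move=> M hM s _ /=; apply: (le_trans _ (ltW hM)).
  have /andP[l h] := vb s; rewrite ler_norml.
  have := ler_norm hi; have := ler_norm (- lo); rewrite normrN.
  have := normr_ge0 lo; have := normr_ge0 hi; lra.
Qed.

Lemma expect_le v w lo hi k : upper_semicontinuous v -> upper_semicontinuous w ->
  (forall s, lo <= v s <= hi) -> (forall s, lo <= w s <= hi) ->
  (forall s, v s <= w s) -> expect q v k <= expect q w k.
Proof.
move=> uv uw vb wb vw; apply: le_Rintegral => //.
- exact: usc_bounded_integrable uv vb.
- exact: usc_bounded_integrable uw wb.
Qed.

Lemma expect_cst (r : R) k : expect q (cst r) k = r.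
Proof. by rewrite /expect Rintegral_cst// prob_kernel mulr1. Qed.

Lemma expectZ v lo hi (l : R) k : upper_semicontinuous v ->
  (forall s, lo <= v s <= hi) ->
  expect q (fun s => l * v s) k = l * expect q v k.
Proof.
by move=> uv vb; apply: RintegralZl => //; exact: usc_bounded_integrable uv vb.
Qed.

Lemma expect_bounds v lo hi k : upper_semicontinuous v ->
  (forall s, lo <= v s <= hi) -> lo <= expect q v k <= hi.
Proof.
move=> uv vb.
(* A point of S yields lo <= hi, so that the constants lo and hi themselves take values in
   [lo, hi]. *)
have [s0 _] : exists s : S, True by exists point.
have lohi : lo <= hi by have /andP[] := vb s0; exact: le_trans.
rewrite -(expect_cst lo k) -(expect_cst hi k); apply/andP; split.
  apply: (@expect_le _ _ lo hi) => //; first exact: usc_cst.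
    by move=> s; rewrite /= lexx.
  by move=> s; have /andP[] := vb s.
apply: (@expect_le _ _ lo hi) => //; first exact: usc_cst.
  by move=> s; rewrite /= lexx lohi.
by move=> s; have /andP[] := vb s.
Qed.

End expectation.

(** * Feller kernels and upper semicontinuous integrands *)

Section feller_usc.
Context (R : realType) (X : metricType R) (Y : topologicalType).
Context (S : borel_set X) (A : borel_set Y) (K : borel_set (S * A)%type).
Context (q : R.-pker (borel K) ~> (borel S)).

(** The expectations of the envelopes are continuous, lie above E(v) and converge to it by dominated
    convergence, so E(v) is their pointwise infimum. *)
Lemma feller_expect_usc (v : S -> R) lo hi : feller q -> upper_semicontinuous v ->
  (forall s, lo <= v s <= hi) -> upper_semicontinuous (expect q v).
Proof.
move=> fq uv vb.
pose F n := lipschitz_envelope v n.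
have Fc n : continuous (F n) by exact: (lipschitz_envelope_continuous vb).
have Fu n : upper_semicontinuous (F n) by case: ((continuous_usc_lsc _).1 (Fc n)).
have vF n s : v s <= F n s <= hi by exact: lipschitz_envelope_bounds.
have Fb n s : lo <= F n s <= hi.
  have /andP[h ->] := vF n s; rewrite andbT (le_trans _ h)//.
  by case/andP: (vb s).
have bnd (r : R) : lo <= r <= hi -> `|r| <= `|lo| + `|hi|.
  move=> /andP[l h]; rewrite ler_norml.
  have := ler_norm hi; have := ler_norm (- lo); rewrite normrN.
  have := normr_ge0 lo; have := normr_ge0 hi; lra.
apply: (@usc_inf _ _ nat (fun n => expect q (F n))).
- move=> n; have : continuous (expect q (F n)).
    by apply: fq => //; exists (`|lo| + `|hi|) => s; exact: bnd.
  by move=> /continuous_usc_lsc[].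
- move=> n k; apply: (expect_le q k uv (Fu n) vb (Fb n)) => s.
  by case/andP: (vF n s).
move=> k a ka.
have cvg : expect q (F n) k @[n --> \oo] --> expect q v k.
  have [] := @dominated_convergence _ (borel S) R (q k) setT measurableT
     (fun n => EFin \o F n) (EFin \o v) (cst (`|lo| + `|hi|)%:E).
  - by move=> n; apply/measurable_EFinP; exact: usc_measurable.
  - by apply/measurable_EFinP; exact: usc_measurable.
  - apply: aeW => s _; apply: cvg_EFin; first exact: nearW.
    exact: (lipschitz_envelope_cvg vb uv).
  - pose c := `|lo| + `|hi|.
    apply: (usc_bounded_integrable (v := cst c) (lo := c) (hi := c) q k).
      exact: usc_cst.
    by move=> s; rewrite /= lexx.
  - by apply: aeW => s n _; rewrite /= lee_fin bnd.
  move=> iv _ cv.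
  apply: fine_cvg; rewrite fineK//.
  exact: integrable_fin_num.
have : \forall n \near \oo, expect q (F n) k < a by exact: cvgr_lt cvg _ ka.
by move=> [n _ /(_ n (leqnn n))] ?; exists n.
Qed.

End feller_usc.

(** * Fixed points of monotone subhomogeneous operators *)

Section subhomogeneous_fixpoint.
Context (R : realType) (S : Type) (P : set (S -> R)) (T : (S -> R) -> (S -> R)).
Context (lo hi k p : R) (lo_gt0 : 0 < lo) (lo_le_hi : lo <= hi).
Context (k_bounds : 0 <= k < 1) (p_neq0 : p != 0).
Context (P_bounds : forall v, P v -> forall s, lo <= v s <= hi).
Context (P_lo : P (cst lo)) (P_hi : P (cst hi)).
Context (P_inf : forall (F : nat -> S -> R) v, (forall n, P (F n)) ->
  (forall n s, v s <= F n s) ->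
  (forall s a, v s < a -> exists n, F n s < a) ->
  (forall s, lo <= v s <= hi) -> P v).
Context (P_stable : forall v, P v -> P (T v)).
Context (T_mono : forall v w, P v -> P w ->
  (forall s, v s <= w s) -> forall s, T v s <= T w s).
Context (T_subhom : forall v w l, P v -> P w -> 1 <= l ->
  (forall s, v s <= l * w s) -> forall s, T v s <= ces k p 1 l * T w s).

Let L n := iter n T (cst lo).
Let U n := iter n T (cst hi).

Let PL n : P (L n). Proof. by elim: n => //= n; exact: P_stable. Qed.
Let PU n : P (U n). Proof. by elim: n => //= n; exact: P_stable. Qed.

Let L_homo : {homo L : m n / (m <= n)%N >-> forall s, m s <= n s}.
Proof.
move=> m n /subnK <-; elim: (n - m)%N => //= i IH s; apply: (le_trans (IH s)).
elim: (i + m)%N s => [s|j IHj s] /=; first by case/andP: (P_bounds (PL 1) s).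
exact: (T_mono (PL j) (PL j.+1) IHj).
Qed.

Let U_homo : {homo U : m n / (m <= n)%N >-> forall s, n s <= m s}.
Proof.
move=> m n /subnK <-; elim: (n - m)%N => //= i IH s; apply: (le_trans _ (IH s)).
elim: (i + m)%N s => [s|j IHj s] /=; first by case/andP: (P_bounds (PU 1) s).
exact: (T_mono (PU j.+1) (PU j) IHj).
Qed.

Let L_le_U m n s : L m s <= U n s.
Proof.
apply: (le_trans (L_homo (leq_maxl m n) s)).
apply: (le_trans _ (U_homo (leq_maxr m n) s)).
elim: (maxn m n) s => //= i IH; exact: (T_mono (PL i) (PU i) IH).
Qed.

(** The induction starts from hi = (hi / lo) lo, and [T_subhom] turns a factor l into [ces k p 1 l]
    at each step. *)
Let U_le_L n s : U n s <= iter n (ces k p 1) (hi / lo) * L n s.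
Proof.
have l1 : 1 <= hi / lo by rewrite ler_pdivlMr// mul1r.
elim: n s => [s|n IH s] /=; first by rewrite divfK// gt_eqF.
apply: T_subhom => //.
by elim: n {IH} => //= n; exact: ces_ge1.
Qed.

(** With l_n the factor of [U_le_L], U_n - L_n <= (l_n - 1) L_n <= (l_n - 1) hi, which is below e
    once l_n < 1 + e / hi. *)
Let gap s (e : R) : 0 < e -> exists n, U n s - L n s < e.
Proof.
move=> e0; have hi0 := lt_le_trans lo_gt0 lo_le_hi.
have l1 : 1 <= hi / lo by rewrite ler_pdivlMr// mul1r.
have c := @iter_ces_cvg1 R k p _ k_bounds p_neq0 l1.
have e1 : 1 < 1 + e / hi by rewrite ltrDl divr_gt0.
have [n _ /(_ n (leqnn n)) /=] : \forall n \near \oo,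
  iter n (ces k p 1) (hi / lo) < 1 + e / hi by exact: cvgr_lt c _ e1.
set l := iter n _ _ => ln; exists n.
have /andP[Llo Lhi] := P_bounds (PL n) s; have := U_le_L n s; rewrite -/l => UL.
have l1' : 1 <= l by rewrite /l; elim: (n) => //= i; exact: ces_ge1.
rewrite -ltrBlDl ltr_pdivlMr// in ln.
have : (l - 1) * L n s <= (l - 1) * hi by rewrite ler_wpM2l// subr_ge0.
lra.
Qed.

Let squeeze x y s : (forall n, L n s <= x <= U n s) ->
  (forall n, L n s <= y <= U n s) -> x = y.
Proof.
move=> hx hy; apply/eqP; rewrite -subr_eq0 -normr_le0; apply/ler_addgt0Pl => e e0.
have [n ne] := gap s e0; have /andP[x1 x2] := hx n; have /andP[y1 y2] := hy n.
by rewrite addr0 ler_norml; apply/andP; split; lra.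
Qed.

(** The infimum v of the U_n, its image T v and every fixed point in P lie between all L_n and U_n,
    and the closing gap leaves room for one function only. The last two conclusions make v the
    supremum of the L_n, from which continuity is later deduced. *)
Lemma subhomogeneous_fixpoint : exists v, [/\ P v, T v = v,
  (forall w, P w -> T w = w -> v = w),
  (forall n s, iter n T (cst lo) s <= v s) &
  (forall s a, a < v s -> exists n, a < iter n T (cst lo) s)].
Proof.
pose v s := inf [set U n s | n in setT].
have Lv n s : L n s <= v s.
  by apply: lb_le_inf; [exists (U 0 s), 0%N|move=> _ [m _ <-]; exact: L_le_U].
have vU n s : v s <= U n s.
  by apply: ge_inf; [exists lo => _ [m _ <-]; exact: L_le_U 0%N m s|exists n].
have LvU n s : L n s <= v s <= U n s by rewrite Lv vU.
have Pv : P v.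
  apply: (P_inf PU) => //.
    move=> s a va; have [|n ne] := @gap s (a - v s); first by rewrite subr_gt0.
    by exists n; have := Lv n s; lra.
  by move=> s; exact: (LvU 0%N).
(* T shifts the enclosure from n to n + 1; index 0 is covered by the bounds that P imposes on T
   w. *)
have fixed_LU w : P w -> (forall n s, L n s <= w s <= U n s) ->
    forall n s, L n s <= T w s <= U n s.
  move=> Pw h [s|n s]; first exact: (P_bounds (P_stable Pw)).
  by apply/andP; split; apply: T_mono => // t; case/andP: (h n t).
exists v; split => //.
- apply/funext => s; apply: (@squeeze _ _ s) => n; last exact: LvU.
  exact: fixed_LU.
- move=> w Pw Tw; apply/funext => s; apply: (@squeeze _ _ s) => n; first exact: LvU.
  elim: n s => [s|n IH s]; first exact: P_bounds.
  by rewrite -Tw; apply/andP; split; apply: T_mono => // t; case/andP: (IH t).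
- move=> s a av; have [|n ne] := @gap s (v s - a); first by rewrite subr_gt0.
  by exists n; have := vU n s; rewrite -/(L n); lra.
Qed.

End subhomogeneous_fixpoint.

(** * The Bellman operator on [Uhat] *)

Section bellman_operator.
Context (R : realType) (X Y : metricType R).
Context (S : borel_set X) (A : borel_set Y) (K : borel_set (S * A)%type).
Context (K_sections : forall s : S, feasible K s !=set0).
Context (q : R.-pker (borel K) ~> (borel S)) (u : K -> R) (b0 b1 : R).
Context (b0_gt0 : 0 < b0) (b0_lt_b1 : b0 < b1).
Context (u_bounds : forall k : K, b0 <= u k <= b1).
Context (beta p : R) (beta_bounds : 0 <= beta < 1) (p_neq0 : p != 0).
Context (epsilon B : R) (epsilon_gt0 : 0 < epsilon) (epsilon_lt_B : epsilon < B).
Context (constants_neg : p < 0 ->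
  epsilon <= b0 /\ (1 - beta) `^ p^-1 * b1 <= B).
Context (constants_pos : 0 < p ->
  epsilon <= (1 - beta) `^ p^-1 * b0 /\ b1 <= B).
Context (K_compact : forall s : S, compact (feasible K s)).
Context (K_usc : usc_correspondence (feasible K)).
Context (u_usc : upper_semicontinuous u) (q_feller : feller q).
Implicit Types v w : S -> R.

Let P : set (S -> R) := Uhat (S := S) epsilon B.
Let agg v (k : K) := aggregator q beta p u v k.
Let values v (s : S) := [set agg v k | k in [set k : K | (val k).1 = s]].

(* The value is 0 where the maximum is not attained. *)
Definition bellman_op v (s : S) : R := xget 0 (is_max (values v s)).

Let u_gt0 k : 0 < u k.
Proof. by case/andP: (u_bounds k) => h _; exact: lt_le_trans h. Qed.

Let expect_in v k : P v -> epsilon <= expect q v k <= B.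
Proof. by move=> [uv vb]; exact: expect_bounds. Qed.

Let expect_gt0 v k : P v -> 0 < expect q v k.
Proof. by move=> Pv; have /andP[h _] := expect_in k Pv; exact: lt_le_trans h. Qed.

Let agg_in v k : P v -> epsilon <= agg v k <= B.
Proof.
by move=> Pv; exact: (ces_bounds beta_bounds p_neq0 b0_gt0 epsilon_gt0
  constants_neg constants_pos (u_bounds k) (expect_in k Pv)).
Qed.

Let agg_usc v : P v -> upper_semicontinuous (agg v).
Proof.
move=> Pv; apply: (@ces_usc _ R beta p u (expect q v)) => //.
  by move=> k; exact: expect_gt0.
by case: Pv => uv vb; exact: (feller_expect_usc q_feller uv vb).
Qed.

Lemma bellman_op_max v s : Uhat epsilon B v -> is_max (values v s) (bellman_op v s).
Proof.
move=> Pv; apply: xgetPex.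
have aB : exists M, forall k, agg v k <= M.
  by exists B => k; case/andP: (agg_in k Pv).
exact: usc_max_attained (agg_usc Pv) aB (@K_compact s) (K_sections s).
Qed.

(** A set of reals has at most one maximum, so the relational Bellman equation is a fixed-point
    equation. *)
Lemma bellman_opP v : Uhat epsilon B v -> bellman q beta p u v <-> bellman_op v = v.
Proof.
move=> Pv; split=> [bv|e s]; last by have := bellman_op_max s Pv; rewrite e.
apply/funext => s; have [Em um] := bellman_op_max s Pv; have [Ev uv] := bv s.
by apply/eqP; rewrite eq_le uv// um.
Qed.

Let bellman_op_in v : P v -> P (bellman_op v).
Proof.
move=> Pv; split.
  apply: (usc_max (agg_usc Pv) (@K_compact) K_usc) => s.
  exact: bellman_op_max.
by move=> s; have [[k _ <-] _] := bellman_op_max s Pv; exact: agg_in.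
Qed.

(** The factor c lets one lemma give both monotonicity, with c = 1, and subhomogeneity, with c a
    value of [ces]. *)
Let bellman_op_le v w (c : R) : P v -> P w -> (forall k, agg v k <= c * agg w k) ->
  0 <= c -> forall s, bellman_op v s <= c * bellman_op w s.
Proof.
move=> Pv Pw h c0 s; have [[k ks <-] _] := bellman_op_max s Pv.
apply: (le_trans (h k)); rewrite ler_wpM2l//.
by apply: (bellman_op_max s Pw).2; exists k.
Qed.

Let agg_mono v w k : P v -> P w -> (forall s, v s <= w s) -> agg v k <= agg w k.
Proof.
move=> Pv Pw vw; apply: ces_le => //; first exact: expect_gt0.
by case: Pv Pw => uv vb [uw wb]; exact: (expect_le q k uv uw vb wb).
Qed.

Let agg_subhom v w l c k : P v -> P w -> 1 <= l -> 0 <= c < 1 ->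
  (forall x y, b0 <= x <= b1 -> epsilon <= y <= B ->
    beta * y `^ p <= c * ((1 - beta) * x `^ p + beta * y `^ p)) ->
  (forall s, v s <= l * w s) -> agg v k <= ces c p 1 l * agg w k.
Proof.
move=> Pv Pw l1 /andP[c0 c1] hc vw; have l0 := lt_le_trans ltr01 l1.
have cc : 0 <= c <= 1 by rewrite c0 ltW.
apply: (le_trans _ (ces_subhomogeneous beta_bounds p_neq0 (u_gt0 k)
  (expect_gt0 k Pw) l1 cc (hc _ _ (u_bounds k) (expect_in k Pw)))).
apply: (ces_le beta_bounds p_neq0 (u_gt0 k) (lexx _) (expect_gt0 k Pv)).
case: (Pv) => uv vb; case: (Pw) => uw wb; rewrite -(expectZ q l k uw wb).
have B0 := lt_trans epsilon_gt0 epsilon_lt_B.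
(* Since l >= 1, both v and l w take values in [epsilon, l B], the common bounds that [expect_le]
   asks for. *)
apply: (@expect_le _ _ _ _ _ _ q _ _ epsilon (l * B)) => //; first exact: usc_scale.
  move=> s; have /andP[-> h] := vb s; rewrite (le_trans h)//=.
  by rewrite ler_peMl// ltW.
move=> s; have /andP[h h'] := wb s; rewrite ler_pM2l// h' andbT.
by rewrite (le_trans h)// ler_peMl// ltW// (lt_le_trans epsilon_gt0).
Qed.

Lemma bellman_op_fixpoint : exists v, [/\ Uhat epsilon B v, bellman_op v = v,
  (forall w, Uhat epsilon B w -> bellman_op w = w -> v = w),
  (forall n s, iter n bellman_op (cst epsilon) s <= v s) &
  (forall s a, a < v s -> exists n, a < iter n bellman_op (cst epsilon) s)].
Proof.
have [c cb hc] := @ces_weight_bound R beta p b0 b1 epsilon B beta_bounds b0_gt0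
  (ltW b0_lt_b1) epsilon_gt0 (ltW epsilon_lt_B).
apply: (@subhomogeneous_fixpoint R S P bellman_op epsilon B c p epsilon_gt0
  (ltW epsilon_lt_B) cb p_neq0).
- by move=> v [].
- by split=> [|s]; [exact: usc_cst|rewrite /= lexx ltW].
- by split=> [|s]; [exact: usc_cst|rewrite /= lexx ltW].
- move=> F v PF vF infF vb; split; last exact: vb.
  by apply: (usc_inf _ vF infF) => n; case: (PF n).
- exact: bellman_op_in.
- move=> v w Pv Pw vw s; rewrite -[leRHS]mul1r.
  apply: (bellman_op_le Pv Pw _ ler01) => k.
  by rewrite mul1r; exact: (agg_mono k Pv Pw vw).
- move=> v w l Pv Pw l1 vw; apply: (bellman_op_le Pv Pw).
    by move=> k; exact: (agg_subhom k Pv Pw l1 cb hc vw).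
  exact: (le_trans ler01 (ces_ge1 cb p_neq0 l1)).
Qed.

(** For continuous v the Feller property applies to v itself, so the aggregator is also lower
    semicontinuous and both halves of the maximum theorem apply. *)
Lemma bellman_op_continuous v : lsc_correspondence (feasible K) ->
  lower_semicontinuousR u -> Uhat epsilon B v -> continuous v ->
  continuous (bellman_op v).
Proof.
move=> K_lsc u_lsc Pv cv; apply/continuous_usc_lsc.
split; first by case: (bellman_op_in Pv).
have : lower_semicontinuousR (agg v).
  apply: (@ces_lsc _ R beta p u (expect q v)) => //.
    by move=> k; exact: expect_gt0.
  have : continuous (expect q v).
    apply: q_feller => //; exists B => s; have [_ /(_ s) /andP[l h]] := Pv.
    by rewrite ger0_norm// ltW// (lt_le_trans epsilon_gt0).
  by move=> /continuous_usc_lsc [].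
by move=> lagg; apply: (lsc_max lagg K_lsc) => s; exact: bellman_op_max.
Qed.

Lemma bellman_op_fixpoint_continuous v : lsc_correspondence (feasible K) ->
  lower_semicontinuousR u -> Uhat epsilon B v ->
  (forall n s, iter n bellman_op (cst epsilon) s <= v s) ->
  (forall s a, a < v s -> exists n, a < iter n bellman_op (cst epsilon) s) ->
  continuous v.
Proof.
move=> K_lsc u_lsc [uv vb] Lv vL; apply/continuous_usc_lsc; split => //.
apply: (@lsc_sup _ _ nat (fun n => iter n bellman_op (cst epsilon))) => // n.
(* Membership in [Uhat] is carried along in the induction because it ensures that the maxima
   defining the next iterate are attained. *)
suff [_ /continuous_usc_lsc []] : P (iter n bellman_op (cst epsilon)) /\
  continuous (iter n bellman_op (cst epsilon)) by [].
elim: n => [|n [Pn cn]] /=; last first.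
  by split; [exact: bellman_op_in|exact: bellman_op_continuous].
split; last exact: cst_continuous.
by split=> [|s]; [exact: usc_cst|rewrite /= lexx ltW].
Qed.

End bellman_operator.


(** * Existence and uniqueness of the solution, and its continuity *)

Theorem theorem9 (R : realType)
    (X : completeMetricType R) (Y : completeMetricType R)
    (sepX : separable X) (sepY : separable Y)
    (S : borel_set X) (A : borel_set Y) (K : borel_set (S * A)%type)
    (K_sections : forall s : S, feasible K s !=set0)
    (q : R.-pker (borel K) ~> (borel S))
    (u : K -> R) (u_measurable : measurable_fun [set: borel K] u)
    (b0 b1 : R) (b0_gt0 : 0 < b0) (b0_lt_b1 : b0 < b1)
    (u_bounds : forall k : K, b0 <= u k <= b1)
    (beta p : R) (beta_bounds : 0 <= beta < 1) (p_lt1 : p < 1) (p_neq0 : p != 0)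
    (epsilon B : R) (epsilon_gt0 : 0 < epsilon) (epsilon_lt_B : epsilon < B)
    (constants_neg : p < 0 ->
       epsilon <= b0 /\ (1 - beta) `^ p^-1 * b1 <= B)
    (constants_pos : 0 < p ->
       epsilon <= (1 - beta) `^ p^-1 * b0 /\ b1 <= B) :
  let is_solution (v : S -> R) :=
    v \in Uhat epsilon B /\ bellman q beta p u v in
  ((forall s : S, compact (feasible K s)) ->
   usc_correspondence (feasible K) ->
   upper_semicontinuous u ->
   feller q ->
   exists! v : S -> R, is_solution v)
  /\
  ((forall s : S, compact (feasible K s)) ->
   continuous_correspondence (feasible K) ->
   continuous u ->
   feller q ->
   exists v : S -> R, unique is_solution v /\ v \in Chat epsilon B).
Proof.
move=> is_solution.
(* Serves both halves, since the continuous assumptions imply the semicontinuous ones; the facts on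
   the iterates are kept for the continuity of the same solution. *)
have solve : (forall s, compact (feasible K s)) ->
    usc_correspondence (feasible K) -> upper_semicontinuous u -> feller q ->
    exists v, [/\ unique is_solution v,
      (forall n s, iter n (bellman_op q u beta p) (cst epsilon) s <= v s) &
      (forall s a, a < v s ->
        exists n, a < iter n (bellman_op q u beta p) (cst epsilon) s)].
  move=> K_compact K_usc u_usc q_feller.
  have [v [Pv Tv uniq_v Lv vL]] := bellman_op_fixpoint K_sections b0_gt0
    b0_lt_b1 u_bounds beta_bounds p_neq0 epsilon_gt0 epsilon_lt_B constants_neg
    constants_pos K_compact K_usc u_usc q_feller.
  have solP w : Uhat epsilon B w ->
      bellman q beta p u w <-> bellman_op q u beta p w = w.
    exact: (bellman_opP K_sections b0_gt0 u_bounds beta_bounds p_neq0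
      epsilon_gt0 constants_neg constants_pos K_compact u_usc q_feller).
  exists v; split => //; split; first by split; [exact: mem_set|exact/solP].
  by move=> w [/set_mem Pw /solP] => /(_ Pw); exact: uniq_v.
split=> [K_compact K_usc u_usc q_feller|].
  by have [v [uniq_v _ _]] := solve K_compact K_usc u_usc q_feller; exists v.
move=> K_compact [K_usc K_lsc] /continuous_usc_lsc [u_usc u_lsc] q_feller.
have [v [sol_v Lv vL]] := solve K_compact K_usc u_usc q_feller.
have Pv : Uhat epsilon B v by case: sol_v => [[/set_mem]].
exists v; split => //; apply: mem_set; split; last by case: Pv.
exact: (bellman_op_fixpoint_continuous K_sections b0_gt0 u_bounds beta_bounds
  p_neq0 epsilon_gt0 epsilon_lt_B constants_neg constants_pos K_compact K_usc
  u_usc q_feller K_lsc u_lsc Pv Lv vL).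
Qed.
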